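(* Let $E$ be a Dedekind complete Riesz space with weak order unit, let $T$ be a strictly positive conditional expectation operator on $E$, let $\mathcal{L}^1(T)$ be the natural domain ($T$-universal completion) of $T$, with $T$ also denoting its extension to $\mathcal{L}^1(T)$, and let $\mathcal{L}^\infty(T):=\{f\in\mathcal{L}^1(T): |f|\le g \text{ for some } g\in R(T)\}$ with $R(T)$-valued norm $\|f\|_{T,\infty}:=\inf\{g\in R(T): |f|\le g\}$. Then each strong Cauchy net in $\mathcal{L}^\infty(T)$ is strongly convergent in $\mathcal{L}^\infty(T)$. That is, if $(f_\alpha)$ is a net in $\mathcal{L}^\infty(T)$ such that $v_\alpha:=\sup_{\beta,\gamma\ge\alpha}\|f_\beta-f_\gamma\|_{T,\infty}$ is eventually defined and has order limit zero, then there exists $f\in\mathcal{L}^\infty(T)$ such that $\|f_\alpha-f\|_{T,\infty}\to 0$ in order.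
   Context: All Riesz spaces (vector lattices) are real. A weak order unit of a Riesz space $E$ is an element $e\in E_+$ such that the band generated by $e$ is $E$. For a Dedekind complete Riesz space $E$, $E^u$ denotes its universal completion: the (unique up to isomorphism) universally complete (i.e. Dedekind complete and laterally complete) Riesz space containing $E$ as an order dense Riesz subspace. Conditional expectation operator: a linear map $T:E\to E$ on a Dedekind complete Riesz space $E$ with weak order unit that is a positive, order continuous projection ($T^2=T$), maps weak order units to weak order units, and whose range $R(T)$ is a Dedekind complete Riesz subspace of $E$. $T$ is strictly positive if $v\in E_+$, $v\neq 0$ implies $Tv\neq 0$. Natural domain: let $D_+$ be the set of $f\in E^u_+$ for which there is an increasing net $(f_\alpha)$ in $E_+$ with $f_\alpha\uparrow f$ in $E^u$ and $(Tf_\alpha)$ bounded above in $E^u$; for such $f$ put $Tf:=\sup_\alpha Tf_\alpha\in E^u$ (independent of the choice of net). Then $\mathcal{L}^1(T):=D_+-D_+=\{f\in E^u: |f|\in D_+\}$, and $T$ is extended linearly to $\mathcal{L}^1(T)$. It is known that $\mathcal{L}^1(T)$ is a Dedekind complete Riesz space with weak order unit, that its universal completion is $E^u$, that the extended $T$ is the unique extension of $T$ to a conditional expectation operator on $\mathcal{L}^1(T)$, that it is strictly positive, and that $\mathcal{L}^1(T)$ is $T$-universally complete: if $(x_\alpha)$ is an increasing net in $\mathcal{L}^1(T)_+$ with $(Tx_\alpha)$ order bounded in $E^u$, then $(x_\alpha)$ is order convergent in $\mathcal{L}^1(T)$. $R(T)$ denotes the range of the extended operator $T$ on $\mathcal{L}^1(T)$;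 it is known to be universally complete. Nets are indexed by (upward) directed sets. ''Eventually defined'' means that there is an index $\alpha_0$ such that for all $\alpha\ge\alpha_0$ the supremum defining $v_\alpha$ exists (in $R(T)$). A net $(x_\alpha)$ in a Dedekind complete Riesz space converges in order to $x$ if it is eventually order bounded and $\limsup_\alpha x_\alpha=\liminf_\alpha x_\alpha=x$. *)

(* Defs.v *)
From HB Require Import structures.
From mathcomp Require Import all_boot all_order all_algebra.
From mathcomp Require Import boolp classical_sets reals.

Set Implicit Arguments.
Unset Strict Implicit.
Unset Printing Implicit Defensive.

Import Order.TTheory GRing.Theory Num.Theory.
Local Open Scope classical_set_scope.
Local Open Scope ring_scope.

(* [Order.Lattice] is not used as a superclass: its join with [GRing.Lmodule]
   would have to be declared below [Num.RealDomain].  The lattice operations are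
   therefore part of the mixin. *)
HB.mixin Record isRiesz (R : realType) (E : Type)
    of Num.POrderedZmodule E & GRing.Lmodule R E := {
  rjoin : E -> E -> E ;
  rmeet : E -> E -> E ;
  rjoin_le : forall x y z : E, (rjoin x y <= z) = (x <= z) && (y <= z) ;
  rmeet_ge : forall x y z : E, (z <= rmeet x y) = (z <= x) && (z <= y) ;
  riesz_leD : forall z x y : E, x <= y -> x + z <= y + z ;
  riesz_scale_ge0 : forall (a : R) (x : E), 0 <= a -> 0 <= x -> 0 <= a *: x
}.

#[short(type="rieszType")]
HB.structure Definition Riesz (R : realType) :=
  {E of isRiesz R E & Num.POrderedZmodule E & GRing.Lmodule R E}.

Section Order_notions.
Context {R : realType} {E : rieszType R}.
Implicit Types (S A B : set E) (x y e l : E).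

Definition rabs x : E := rjoin x (- x).

(* Suprema and infima computed in the ordered subset [S] of [E], as sets with
   at most one element.  They may differ from those computed in [E]; the
   latter are obtained with [S := setT]. *)
Definition sups_in S A : set E :=
  (S `&` ubound A) `&` lbound (S `&` ubound A).
Definition infs_in S A : set E :=
  (S `&` lbound A) `&` ubound (S `&` lbound A).

Definition dedekind_complete S : Prop :=
  forall A, A `<=` S -> A !=set0 -> (S `&` ubound A) !=set0 ->
    sups_in S A !=set0.

(* Nonemptiness of [A] is needed: a supremum of [set0] in [E] would be a least
   element of [E]. *)
Definition laterally_complete : Prop :=
  forall A, A !=set0 -> (forall x, A x -> 0 <= x) ->
    (forall x y, A x -> A y -> x <> y -> rmeet x y = 0) ->
    sups_in setT A !=set0.

Definition universally_complete : Prop :=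
  dedekind_complete setT /\ laterally_complete.

Definition subspace S : Prop :=
  S 0 /\ (forall (a : R) x y, S x -> S y -> S (a *: x + y)).

Definition riesz_subspace S : Prop :=
  subspace S /\
  (forall x y, S x -> S y -> S (rjoin x y) /\ S (rmeet x y)).

Definition ideal S : Prop :=
  subspace S /\ (forall x y, S y -> rabs x <= rabs y -> S x).

Definition band S : Prop :=
  ideal S /\ (forall A x, A `<=` S -> sups_in setT A x -> S x).

Definition weak_order_unit e : Prop :=
  0 <= e /\ smallest band [set e] = setT.

Definition order_dense S : Prop :=
  forall x, 0 < x -> exists2 y, S y & 0 < y <= x.

End Order_notions.

Definition directed (I : Type) (le : I -> I -> Prop) : Prop :=
  [/\ inhabited I,
      forall a, le a a,
      forall a b c, le a b -> le b c -> le a c &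
      forall a b, exists2 c, le a c & le b c].

Section Nets.
Context {R : realType} {E : rieszType R}.
Context {I : Type} (le : I -> I -> Prop).
Implicit Types (S : set E) (x : I -> E) (l : E).

Definition increasing_net x : Prop := forall a b, le a b -> x a <= x b.

(* Order convergence in [S], meant for [S] Dedekind complete: then the suprema
   and infima of the tails beyond [a0] below all exist. *)
Definition order_cvg_in S x l : Prop :=
  exists a0 : I,
    [/\ exists m M, [/\ S m, S M &
          forall a, le a0 a -> S (x a) /\ m <= x a <= M],
        infs_in S [set s | exists2 a, le a0 a &
                     sups_in S (x @` [set b | le a b]) s] l &
        sups_in S [set s | exists2 a, le a0 a &
                     infs_in S (x @` [set b | le a b]) s] l].

End Nets.

Definition order_continuous (R : realType) (E F : rieszType R) (T : E -> F) :
    Prop :=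
  forall (I : Type) (le : I -> I -> Prop), directed le ->
  forall (x : I -> E) (l : E),
    order_cvg_in le setT x l -> order_cvg_in le setT (T \o x) (T l).

Record conditional_expectation (R : realType) (E : rieszType R)
    (T : {linear E -> E}) : Prop := {
  ce_positive : forall x : E, 0 <= x -> 0 <= T x ;
  ce_order_continuous : order_continuous T ;
  ce_projection : forall x : E, T (T x) = T x ;
  ce_weak_order_unit : forall e : E,
    weak_order_unit e -> weak_order_unit (T e) ;
  ce_range_riesz : riesz_subspace (range T) ;
  ce_range_dedekind : dedekind_complete (range T)
}.

Definition strictly_positive (R : realType) (E : rieszType R)
    (T : {linear E -> E}) : Prop :=
  forall v : E, 0 <= v -> v <> 0 -> T v <> 0.

(* [Eu], together with the embedding [j], is a universal completion of [E]. *)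
Record universal_completion (R : realType) (E Eu : rieszType R)
    (j : {linear E -> Eu}) : Prop := {
  uc_complete : universally_complete (E := Eu) ;
  uc_inj : injective j ;
  uc_join : forall x y : E, j (rjoin x y) = rjoin (j x) (j y) ;
  uc_dense : order_dense (range j)
}.

Section Natural_domain.
Context {R : realType} {E Eu : rieszType R}.
Variables (j : {linear E -> Eu}) (T : {linear E -> E}).
Implicit Types f g n : Eu.

(* Graph of the extension of [T] to the positive cone of its natural domain:
   [g = sup_a T x_a] for an increasing net [x_a] of [E_+] with supremum [f]
   in [Eu].  (The boundedness of [T x_a] in [Eu] is part of [g] being a
   supremum.) *)
Definition ext_pos f g : Prop :=
  exists (I : Type) (le : I -> I -> Prop) (x : I -> E),
    [/\ directed le,
        increasing_net le x,
        forall a, 0 <= x a,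
        sups_in setT (range (j \o x)) f &
        sups_in setT (range (j \o (T \o x))) g].

Definition nat_dom_pos : set Eu :=
  [set f | 0 <= f /\
     exists (I : Type) (le : I -> I -> Prop) (x : I -> E),
       [/\ directed le,
           increasing_net le x,
           forall a, 0 <= x a,
           sups_in setT (range (j \o x)) f &
           has_ubound (range (j \o (T \o x)))]].

Definition L1 : set Eu :=
  [set f | exists f1 f2,
     [/\ nat_dom_pos f1, nat_dom_pos f2 & f = f1 - f2]].

(* Graph of the linear extension of [T] to [L1]. *)
Definition ext f g : Prop :=
  exists f1 f2 g1 g2,
    [/\ ext_pos f1 g1, ext_pos f2 g2, f = f1 - f2 & g = g1 - g2].

Definition ext_range : set Eu := [set g | exists2 f, L1 f & ext f g].

Definition Linfty : set Eu :=
  [set f | L1 f /\ exists2 g, ext_range g & rabs f <= g].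

(* The infimum is taken in [ext_range]; the default value [0] is only used
   outside of [Linfty]. *)
Definition Linfty_norm f : Eu :=
  xget 0 (infs_in ext_range [set g | ext_range g /\ rabs f <= g]).

Definition strong_cauchy (I : Type) (le : I -> I -> Prop) (f : I -> Eu) :
    Prop :=
  exists v : I -> Eu,
    (exists a0, forall a, le a0 a ->
       sups_in ext_range
         [set n | exists b c,
            [/\ le a b, le a c & n = Linfty_norm (f b - f c)]] (v a)) /\
    order_cvg_in le ext_range v 0.

Definition strong_cvg (I : Type) (le : I -> I -> Prop) (f : I -> Eu)
    (l : Eu) : Prop :=
  order_cvg_in le ext_range (fun a => Linfty_norm (f a - l)) 0.

End Natural_domain.

(* Main.v *)
(* Put H = R(T), embedded in E^u. It is a Riesz subspace closed under infima of
   positive sets, because T is order continuous. As T fixes H, the range of the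
   extended T is G = Q - Q, where Q is the set of suprema in E^u of subsets of
   the positive cone of H. Both Q and G inherit the closure under infima, so
   infima in G are infima in E^u and |f| <= ||f||.
   For a Cauchy net, |f_b - f_c| <= v_a for b, c >= a, so l = sup (f_a - v_a)
   exists in E^u and satisfies |f_a - l| <= v_a. *)

Require Import Defs.
From HB Require Import structures.
From mathcomp Require Import all_boot all_order all_algebra.
From mathcomp Require Import boolp classical_sets reals.

Set Implicit Arguments.
Unset Strict Implicit.
Unset Printing Implicit Defensive.

Import Order.TTheory GRing.Theory Num.Theory.
Local Open Scope classical_set_scope.
Local Open Scope ring_scope.

(** * Arithmetic in Riesz spaces, and suprema and infima relative to a subset *)

Section RieszTheory.
Context {R : realType} {F : rieszType R}.
Implicit Types (x y z t : F) (S A : set F).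

Lemma riesz_leDr z x y : (x + z <= y + z) = (x <= y).
Proof.
apply/idP/idP => [h|]; last exact: riesz_leD.
by have := riesz_leD (- z) _ _ h; rewrite !addrK.
Qed.

Lemma riesz_leDl z x y : (z + x <= z + y) = (x <= y).
Proof. by rewrite ![z + _]addrC riesz_leDr. Qed.

Lemma riesz_leBlDr x y z : (x - y <= z) = (x <= z + y).
Proof. by rewrite -(riesz_leDr y (_ - _)) subrK. Qed.

Lemma riesz_leBrDr x y z : (x <= z - y) = (x + y <= z).
Proof. by rewrite -(riesz_leDr y x) subrK. Qed.

Lemma riesz_subr_ge0 x y : (0 <= x - y) = (y <= x).
Proof. by rewrite riesz_leBrDr add0r. Qed.

Lemma riesz_leN2 x y : (- x <= - y) = (y <= x).
Proof. by rewrite -(riesz_leDr x (- x)) addNr addrC riesz_subr_ge0. Qed.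

Lemma riesz_leD2 x y z t : x <= y -> z <= t -> x + z <= y + t.
Proof.
move=> xy zt; apply: (@le_trans _ _ (y + z)); first by rewrite riesz_leDr.
by rewrite riesz_leDl.
Qed.

Lemma riesz_addr_ge0 x y : 0 <= x -> 0 <= y -> 0 <= x + y.
Proof. by move=> x0 y0; rewrite -[0]addr0; exact: riesz_leD2. Qed.

Lemma rjoin_ubl x y : x <= rjoin x y.
Proof. by have := lexx (rjoin x y); rewrite {1}rjoin_le => /andP[]. Qed.

Lemma rjoin_ubr x y : y <= rjoin x y.
Proof. by have := lexx (rjoin x y); rewrite {1}rjoin_le => /andP[]. Qed.

Lemma rmeet_lbl x y : rmeet x y <= x.
Proof. by have := lexx (rmeet x y); rewrite {1}rmeet_ge => /andP[]. Qed.

Lemma rmeet_lbr x y : rmeet x y <= y.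
Proof. by have := lexx (rmeet x y); rewrite {1}rmeet_ge => /andP[]. Qed.

Lemma rjoin_idPr x y : (x <= y) = (rjoin x y == y).
Proof.
apply/idP/eqP => [xy|<-]; last exact: rjoin_ubl.
by apply: le_anti; rewrite rjoin_ubr rjoin_le xy lexx.
Qed.

Lemma rmeet_idPl x y : x <= y -> rmeet x y = x.
Proof. by move=> xy; apply: le_anti; rewrite rmeet_lbl rmeet_ge xy lexx. Qed.

Lemma rmeetE x y : rmeet x y = x + y - rjoin x y.
Proof.
apply: le_anti; apply/andP; split; last first.
  rewrite rmeet_ge !riesz_leBlDr riesz_leDl rjoin_ubr.
  by rewrite [x + y]addrC riesz_leDl rjoin_ubl.
rewrite riesz_leBrDr addrC -riesz_leBrDr rjoin_le !riesz_leBrDr riesz_leDl.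
by rewrite [x + y]addrC riesz_leDl rmeet_lbl rmeet_lbr.
Qed.

Lemma rabs_le x y : (rabs x <= y) = (- y <= x <= y).
Proof. by rewrite /rabs rjoin_le andbC -{1}[y]opprK riesz_leN2. Qed.

Lemma rabs_ge0 x : 0 <= rabs x.
Proof.
have : 0 <= rabs x + rabs x.
  by rewrite -{1}(subrr x) riesz_leD2 // (rjoin_ubl, rjoin_ubr).
have half0 : 0 <= 2%:R^-1 :> R by rewrite invr_ge0 ler0n.
move=> /(riesz_scale_ge0 _ _ half0).
by rewrite -mulr2n -scaler_nat scalerA mulVf ?scale1r // pnatr_eq0.
Qed.

Lemma infs_inP S A m :
  infs_in S A m <->
  [/\ S m, forall x, A x -> m <= x &
      forall w, S w -> (forall x, A x -> w <= x) -> w <= m].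
Proof.
split=> [[[Sm lbm] ubm]|[Sm lbm ubm]].
  by split=> // w Sw lbw; apply: ubm.
by split=> [|w [Sw lbw]]; [split | exact: ubm].
Qed.

Lemma sups_inP S A s :
  sups_in S A s <->
  [/\ S s, forall x, A x -> x <= s &
      forall w, S w -> (forall x, A x -> x <= w) -> s <= w].
Proof.
split=> [[[Ss ubs] lbs]|[Ss ubs lbs]].
  by split=> // w Sw ubw; apply: lbs.
by split=> [|w [Sw ubw]]; [split | exact: lbs].
Qed.

Lemma infs_in_uniq S A m n : infs_in S A m -> infs_in S A n -> m = n.
Proof.
move=> /infs_inP[Sm lm um] /infs_inP[Sn ln un].
by apply: le_anti; rewrite un //= um.
Qed.

Lemma dedekind_inf S A b : subspace S -> dedekind_complete S ->
  A `<=` S -> A !=set0 -> S b -> (forall x, A x -> b <= x) ->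
  exists m, infs_in S A m.
Proof.
move=> [S0 Slin] Sc AS [a Aa] Sb lbb.
have SN x : S x -> S (- x).
  by move=> Sx; rewrite -[- x]addr0 -scaleN1r; exact: Slin.
have [s /sups_inP[Ss ubs lbs]] : sups_in S (-%R @` A) !=set0.
  apply: Sc; first by move=> _ [x Ax <-]; exact/SN/AS.
    by exists (- a); exists a.
  exists (- b); split; first exact: SN.
  by move=> _ [x Ax <-]; rewrite riesz_leN2 lbb.
exists (- s); apply/infs_inP; split; first exact: SN.
  by move=> x Ax; rewrite -[x]opprK riesz_leN2 ubs //; exists x.
move=> w Sw lbw; rewrite -[w]opprK riesz_leN2 lbs //; first exact: SN.
by move=> _ [x Ax <-]; rewrite riesz_leN2 lbw.
Qed.

(** One half of the infinite distributive law. By [rmeetE] the hypothesis reads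
    [x <= z + rjoin x y - y]; replacing [x] by [s] on the right makes the bound independent of [x],
    so the supremum can be taken on the left. *)
Lemma rmeet_sup A s y z : sups_in setT A s ->
  (forall x, A x -> rmeet x y <= z) -> rmeet s y <= z.
Proof.
move=> /sups_inP[_ ubs lbs] Az; rewrite rmeetE riesz_leBlDr -riesz_leBrDr.
apply: lbs => // x Ax; rewrite riesz_leBrDr; have := Az _ Ax.
rewrite rmeetE riesz_leBlDr => /le_trans; apply; rewrite riesz_leDl rjoin_le.
by rewrite rjoin_ubr (le_trans (ubs _ Ax)) // rjoin_ubl.
Qed.

End RieszTheory.

(** * The cone of suprema of an order closed Riesz subspace, and its span *)

Section OrderClosedSublattice.
Context {R : realType} {F : rieszType R}.
Implicit Types (x y z g h : F) (A H : set F).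

(** The infimum is taken in the ambient space and is required to fall in [H], so infima relative to
    [H] agree with ambient ones. Positivity only serves as a lower bound. *)
Definition inf_closed H : Prop :=
  forall A, A `<=` H -> A !=set0 -> (forall x, A x -> 0 <= x) ->
    exists2 m, H m & infs_in setT A m.

(** The set [Q] of the overview. A supremum of positive elements of [H] is also the supremum of all
    positive elements of [H] below it, and this canonical family avoids carrying a chosen one. *)
Definition sup_cone H : set F :=
  [set g | 0 <= g /\ sups_in setT [set x | [/\ H x, 0 <= x & x <= g]] g].

Definition sup_span H : set F :=
  [set g | exists g1 g2, [/\ sup_cone H g1, sup_cone H g2 & g = g1 - g2]].

(** The reflection [x |-> b - x] turns [A] into a set of positive elements of [H] and suprema into
    infima. *)
Lemma inf_closed_sup H A b : (forall x y, H x -> H y -> H (x - y)) ->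
  inf_closed H -> A `<=` H -> A !=set0 -> H b -> (forall x, A x -> x <= b) ->
  exists2 s, H s & sups_in setT A s.
Proof.
move=> HB Hinf AH [a Aa] Hb ub.
have [||_ [x Ax <-]|m Hm /infs_inP[_ lm um]] := Hinf [set b - x | x in A].
- by move=> _ [x Ax <-]; apply: HB => //; exact: AH.
- by exists (b - a); exists a.
- by rewrite riesz_subr_ge0 ub.
exists (b - m); first exact: HB.
apply/sups_inP; split=> // [x Ax|w _ wub].
  by rewrite riesz_leBrDr addrC -riesz_leBrDr lm //; exists x.
rewrite riesz_leBlDr addrC -riesz_leBlDr um // => _ [x Ax <-].
by rewrite riesz_leDl riesz_leN2 wub.
Qed.

Context (H : set F).
Hypotheses (Fdc : dedekind_complete (E := F) setT).
Hypotheses (Hriesz : riesz_subspace H) (Hinf : inf_closed H).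

Let H0 : H 0. Proof. by case: Hriesz => -[]. Qed.

Let HN x : H x -> H (- x).
Proof.
by case: Hriesz => -[_ L] _ Hx; rewrite -[- x]addr0 -scaleN1r; exact: L.
Qed.

Let HD x y : H x -> H y -> H (x + y).
Proof. by case: Hriesz => -[_ L] _ Hx Hy; rewrite -[x]scale1r; exact: L. Qed.

Let HB x y : H x -> H y -> H (x - y).
Proof. by move=> Hx /HN; exact: HD. Qed.

Let Hjoin x y : H x -> H y -> H (rjoin x y).
Proof. by case: Hriesz => _ L Hx Hy; case: (L x y). Qed.

Let Hmeet x y : H x -> H y -> H (rmeet x y).
Proof. by case: Hriesz => _ L Hx Hy; case: (L x y). Qed.

Lemma sup_cone_intro g : 0 <= g ->
  (forall z, (forall x, H x -> 0 <= x -> x <= g -> x <= z) -> g <= z) ->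
  sup_cone H g.
Proof.
move=> g0 ub; split=> //; apply/sups_inP; split=> // [x []//|w _ wub].
by apply: ub => x Hx x0 xg; apply: wub.
Qed.

Lemma sup_cone_elim g z : sup_cone H g ->
  (forall x, H x -> 0 <= x -> x <= g -> x <= z) -> g <= z.
Proof. by move=> [_ /sups_inP[_ _ lub]] ub; apply: lub => // x []; exact: ub. Qed.

Lemma sup_cone_id x : H x -> 0 <= x -> sup_cone H x.
Proof. by move=> Hx x0; apply: sup_cone_intro => // z; apply. Qed.

(** If [x <= g] and [y <= h] in [H], then [x + y] is an admissible element below [g + h]; take the
    supremum over [y] first, then over [x]. *)
Lemma sup_coneD g h : sup_cone H g -> sup_cone H h -> sup_cone H (g + h).
Proof.
move=> Qg Qh; have [g0 _] := Qg; have [h0 _] := Qh.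
apply: sup_cone_intro; first exact: riesz_addr_ge0.
move=> z ub; rewrite -riesz_leBrDr; apply: (sup_cone_elim Qg) => x Hx x0 xg.
rewrite riesz_leBrDr addrC -riesz_leBrDr.
apply: (sup_cone_elim Qh) => y Hy y0 yh; rewrite riesz_leBrDr addrC.
by apply: ub; [exact: HD | exact: riesz_addr_ge0 | exact: riesz_leD2].
Qed.

(** By distributivity the meet is the supremum of the elements [rmeet x h], which lie in [H] and are
    bounded by [h], itself in [H]. *)
Lemma sup_cone_meet g h : sup_cone H g -> H h -> 0 <= h -> H (rmeet g h).
Proof.
move=> Qg Hh h0; have [g0 supg] := Qg.
have [||_ [x [Hx x0 xg] <-]|s Hs /sups_inP[_ ubs lubs]] := @inf_closed_sup
  H [set rmeet x h | x in [set x | [/\ H x, 0 <= x & x <= g]]] h HB Hinf _ _ Hh _.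
- by move=> _ [x [Hx x0 xg] <-]; exact: Hmeet.
- by exists (rmeet 0 h); exists 0.
- exact: rmeet_lbr.
suff -> : rmeet g h = s by [].
apply: le_anti; apply/andP; split.
  by apply: (rmeet_sup supg) => x xP; apply: ubs; exists x.
apply: lubs => // _ [x [Hx x0 xg] <-].
by rewrite rmeet_ge rmeet_lbr andbT (le_trans (rmeet_lbl _ _)).
Qed.

(** Fix [a] in [A]. Then [m = rmeet a m] is approached by [rmeet h m] with [h] in [H] below [a].
    Each of these is the infimum of the [rmeet g h], [g] in [A], which belong to [H] by
    [sup_cone_meet]; so it lies in [H] as well. *)
Lemma sup_cone_inf A m : A `<=` sup_cone H -> A !=set0 ->
  infs_in setT A m -> sup_cone H m.
Proof.
move=> AQ [a Aa] /infs_inP[_ lm um]; have Qa := AQ _ Aa; have [a0 supa] := Qa.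
apply: sup_cone_intro; first by apply: um => // x /AQ[].
move=> z ub; have ma := lm _ Aa.
rewrite -(rmeet_idPl ma); have -> : rmeet m a = rmeet a m.
  by apply: le_anti; rewrite !rmeet_ge !rmeet_lbl !rmeet_lbr.
apply: (rmeet_sup supa) => h [Hh h0 ha].
have [||_ [g Ag <-]|n Hn /infs_inP[_ ln un]] :=
  Hinf (A := [set rmeet g h | g in A]).
- by move=> _ [g Ag <-]; apply: sup_cone_meet => //; exact: AQ.
- by exists (rmeet a h); exists a.
- by rewrite rmeet_ge h0 andbT; case: (AQ _ Ag).
have n0 : 0 <= n.
  by apply: un => // _ [g Ag <-]; rewrite rmeet_ge h0 andbT; case: (AQ _ Ag).
have nm : n <= m.
  apply: um => // g Ag; apply: (@le_trans _ _ (rmeet g h)); last exact: rmeet_lbl.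
  by apply: ln; exists g.
apply: (@le_trans _ _ n); last exact: ub.
apply: un => // _ [g Ag <-]; rewrite rmeet_ge rmeet_lbl andbT.
exact: le_trans (rmeet_lbr _ _) (lm _ Ag).
Qed.

(** For [x] in [H] below [g], the element [rjoin x b - b] is positive, in [H] and below [g - b]. *)
Lemma sup_coneB_sub g b : sup_cone H g -> H b -> 0 <= b -> b <= g ->
  sup_cone H (g - b).
Proof.
move=> Qg Hb b0 bg; apply: sup_cone_intro; first by rewrite riesz_subr_ge0.
move=> z ub; rewrite riesz_leBlDr; apply: (sup_cone_elim Qg) => x Hx x0 xg.
apply: (@le_trans _ _ (rjoin x b)); first exact: rjoin_ubl.
rewrite -riesz_leBlDr; apply: ub.
- by apply: HD; [exact: Hjoin | exact: HN].
- by rewrite riesz_subr_ge0 rjoin_ubr.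
- by rewrite riesz_leDr rjoin_le xg.
Qed.

(** The difference is the infimum of [g - b] over positive [b] in [H] below [h]; each [g - b] is in
    the cone, which is closed under infima. *)
Lemma sup_coneB g h : sup_cone H g -> sup_cone H h -> h <= g ->
  sup_cone H (g - h).
Proof.
move=> Qg Qh hg; have [h0 _] := Qh.
apply: (@sup_cone_inf [set g - b | b in [set b | [/\ H b, 0 <= b & b <= h]]]).
- by move=> _ [b [Hb b0 bh] <-]; apply: sup_coneB_sub; rewrite // (le_trans bh).
- by exists (g - 0); exists 0.
apply/infs_inP; split=> // [_ [b [Hb b0 bh] <-]|w _ lbw].
  by rewrite riesz_leDl riesz_leN2.
rewrite riesz_leBrDr addrC -riesz_leBrDr.
apply: (sup_cone_elim Qh) => b Hb b0 bh.
by rewrite riesz_leBrDr addrC -riesz_leBrDr; apply: lbw; exists b.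
Qed.

Lemma sup_cone_span g : sup_cone H g -> sup_span H g.
Proof.
by move=> Qg; exists g, 0; split; [| exact: sup_cone_id | rewrite subr0].
Qed.

Lemma sup_spanB g h : sup_span H g -> sup_span H h -> sup_span H (g - h).
Proof.
move=> [g1 [g2 [Q1 Q2 ->]]] [h1 [h2 [P1 P2 ->]]].
exists (g1 + h2), (g2 + h1); split; [exact: sup_coneD..|].
by rewrite opprB addrACA opprD.
Qed.

Lemma sup_span_ge0 g : sup_span H g -> 0 <= g -> sup_cone H g.
Proof.
by move=> [g1 [g2 [Q1 Q2 ->]]]; rewrite riesz_subr_ge0; exact: sup_coneB.
Qed.

(** The infimum exists because [0] is a lower bound. Positive elements of the span are in the cone,
    so closure of the cone under infima applies. *)
Lemma sup_span_inf_closed : inf_closed (sup_span H).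
Proof.
move=> A AG A0 Age0.
have subT : subspace (E := F) setT by [].
have [m minf] := dedekind_inf subT Fdc (@subsetT _ A) A0 I Age0.
exists m => //; apply/sup_cone_span/(sup_cone_inf _ A0 minf) => x Ax.
by apply: sup_span_ge0; [exact: AG | exact: Age0].
Qed.

End OrderClosedSublattice.

(** * Passing to relative bounds, and order convergence of decreasing nets *)

Lemma sups_in_subset (R : realType) (F : rieszType R) (S A : set F) (s : F) :
  S s -> sups_in setT A s -> sups_in S A s.
Proof.
by move=> Ss /sups_inP[_ us ls]; apply/sups_inP; split=> // w _; exact: ls.
Qed.

Lemma infs_in_subset (R : realType) (F : rieszType R) (S A : set F) (m : F) :
  S m -> infs_in setT A m -> infs_in S A m.
Proof.
by move=> Sm /infs_inP[_ lm um]; apply/infs_inP; split=> // w _; exact: um.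
Qed.

Lemma rabs_leB (R : realType) (F : rieszType R) (x y a b : F) :
  rabs x <= a -> rabs y <= b -> rabs (x - y) <= a + b.
Proof.
rewrite !rabs_le => /andP[ax xa] /andP[bY yb]; apply/andP; split.
  by rewrite opprD; apply: riesz_leD2; rewrite ?riesz_leN2.
by apply: riesz_leD2 => //; rewrite -[b]opprK riesz_leN2.
Qed.

(** The supremum of a tail is its first term, and by directedness every tail has the same lower
    bounds as the whole net. This gives order continuity of [T] a form that speaks of infima. *)
Lemma decreasing_order_cvg (R : realType) (F : rieszType R) (I : Type)
    (le : I -> I -> Prop) (x : I -> F) (l : F) :
  directed le -> (forall a b, le a b -> x b <= x a) ->
  order_cvg_in le setT x l <-> infs_in setT (range x) l.
Proof.
move=> [[i0] lexx' le_tr dir] xdec.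
have tail_sup a : sups_in setT (x @` [set b | le a b]) (x a).
  apply/sups_inP; split=> // [_ [b ab <-]|w _]; first exact: xdec.
  by apply; exists a => //; exact: lexx'.
split=> [[a0 [_ /infs_inP[_ ll ul] _]]|/infs_inP[_ ll ul]].
  apply/infs_inP; split=> // [_ [b _ <-]|w _ lbw].
    have [c a0c bc] := dir a0 b; apply: (@le_trans _ _ (x c)); last exact: xdec.
    by apply: ll; exists c => //; exact: tail_sup.
  apply: ul => // s [a _ /sups_inP[_ us _]].
  apply: (@le_trans _ _ (x a)); first by apply: lbw; exists a.
  by apply: us; exists a => //; exact: lexx'.
have xl a : l <= x a by apply: ll; exists a.
have wl a w : (forall b, le a b -> w <= x b) -> w <= l.
  move=> wx; apply: ul => // _ [b _ <-]; have [c ac bc] := dir a b.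
  exact: le_trans (wx _ ac) (xdec _ _ bc).
exists i0; split.
- by exists l, (x i0); split=> // a ia; split=> //; rewrite xl xdec.
- apply/infs_inP; split=> // [s [a _ /sups_inP[_ us _]]|w _ lbw].
    by apply: (le_trans (xl a)); apply: us; exists a => //; exact: lexx'.
  by apply: (wl i0) => a ia; apply: lbw; exists a => //; exact: tail_sup.
apply/sups_inP; split=> // [s [a _ /infs_inP[_ ls _]]|w _ ubw].
  by apply: (wl a) => b ab; apply: ls; exists b.
apply: ubw; exists i0; first exact: lexx'.
apply/infs_inP; split=> // [_ [b _ <-]//|v _ lbv].
by apply: (wl i0) => b ib; apply: lbv; exists b.
Qed.

(** * The range of [T] in the universal completion, and its extension to the natural domain *)

Section NaturalDomain.
Context {R : realType} {E Eu : rieszType R}.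
Context (j : {linear E -> Eu}) (T : {linear E -> E}).
Hypotheses (E_complete : dedekind_complete (E := E) setT).
Hypotheses (j_univ : universal_completion j) (T_ce : conditional_expectation T).
Implicit Types (x y : E) (f g v w z : Eu).

Let Eu_dc : dedekind_complete (E := Eu) setT.
Proof. by case: (uc_complete j_univ). Qed.

Let T_le x y : x <= y -> T x <= T y.
Proof.
by rewrite -riesz_subr_ge0 => /(ce_positive T_ce); rewrite linearB riesz_subr_ge0.
Qed.

Lemma uc_le x y : (j x <= j y) = (x <= y).
Proof. by rewrite !rjoin_idPr -(uc_join j_univ) (inj_eq (uc_inj j_univ)). Qed.

Lemma uc_ge0 x : (0 <= j x) = (0 <= x).
Proof. by rewrite -(linear0 j) uc_le. Qed.

Lemma uc_meet x y : j (rmeet x y) = rmeet (j x) (j y).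
Proof. by rewrite !rmeetE linearB linearD (uc_join j_univ). Qed.

(** Order density makes [f] the supremum of the positive elements of [E] below it. Otherwise that
    supremum [t] leaves room for some [0 < j y <= f - t]. *)
Lemma uc_dense_sup f z : 0 <= f ->
  (forall x, 0 <= x -> j x <= f -> j x <= z) -> f <= z.
Proof.
move=> f0 ub; pose A := j @` [set x | 0 <= x /\ j x <= f].
have [t /sups_inP[_ ut lt_]] : sups_in setT A !=set0.
  apply: Eu_dc => //; last by exists f; split=> // _ [x [_ xf] <-].
  by exists (j 0); exists 0 => //; split; rewrite ?linear0.
have tf : t <= f by apply: lt_ => // _ [x [_ xf] <-].
have tz : t <= z by apply: lt_ => // _ [x [x0 xf] <-]; exact: ub.
suff -> : f = t by [].
apply: contrapT => /eqP ft.
have : 0 < f - t by rewrite lt_def subr_eq0 ft riesz_subr_ge0.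
move=> /(uc_dense j_univ)[_ [y _ <-] /andP[y0 yft]].
(* If [j x <= f], then [j x <= t], so [j (x + y)] is still below [f] and hence below [t]. This
   forces [j y <= 0]. *)
have : t <= t - j y.
  apply: lt_ => // _ [x [x0 xf] <-]; rewrite riesz_leBrDr -linearD; apply: (ut).
  exists (x + y) => //; split.
    by apply: riesz_addr_ge0 => //; rewrite -uc_ge0 ltW.
  rewrite linearD -[f](subrK t) addrC; apply: riesz_leD2 => //.
  by apply: ut; exists x.
rewrite -{1}[t]addr0 riesz_leDl -oppr0 riesz_leN2 => jy0.
by have := lt_le_trans y0 jy0; rewrite ltxx.
Qed.

(** For a lower bound [w] in [Eu], any positive [y] with [j y] below [rjoin w (j m) - j m] makes
    [y + m] a lower bound of [A], so [y <= 0]; density then gives [w <= j m]. *)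
Lemma uc_inf (A : set E) m : infs_in setT A m -> infs_in setT (j @` A) (j m).
Proof.
move=> /infs_inP[_ lm um]; apply/infs_inP; split=> // [_ [x Ax <-]|w _ lbw].
  by rewrite uc_le lm.
apply: (le_trans (rjoin_ubl w (j m))); rewrite -[X in _ <= X]add0r -riesz_leBlDr.
apply: uc_dense_sup; first by rewrite riesz_subr_ge0 rjoin_ubr.
move=> y y0; rewrite riesz_leBrDr -linearD => yw.
rewrite -(linear0 j) uc_le -(riesz_leDr m) add0r; apply: um => // x Ax.
rewrite -uc_le (le_trans yw) // rjoin_le lbw ?uc_le ?lm //.
Qed.

Definition uc_range : set Eu := j @` range T.

Lemma uc_range_riesz : riesz_subspace uc_range.
Proof.
have [[R0 RL] Rlat] := ce_range_riesz T_ce; split; first split.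
- by exists 0 => //; rewrite linear0.
- move=> a _ _ [x Rx <-] [y Ry <-]; exists (a *: x + y); first exact: RL.
  by rewrite linearP.
move=> _ _ [x Rx <-] [y Ry <-]; have [Rj Rm] := Rlat _ _ Rx Ry.
by split; [exists (rjoin x y); rewrite ?(uc_join j_univ)
          | exists (rmeet x y); rewrite ?uc_meet].
Qed.

Lemma range_fixed x : range T x -> T x = x.
Proof. by case=> y _ <-; exact: ce_projection. Qed.

Lemma ce_range_inf_closed : inf_closed (range T).
Proof.
move=> A AR A0 Age0.
have subT : subspace (E := E) setT by [].
have [m minf] := dedekind_inf subT E_complete (@subsetT _ A) A0 Logic.I Age0.
exists m => //; have /infs_inP[_ lm um] := minf.
(* The range elements above [m] decrease to [m] and are fixed by [T]. *)
pose P x := range T x /\ m <= x.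
pose I := {x : E | P x}.
pose le (a b : I) := sval b <= sval a.
have [[R0 RL] Rlat] := ce_range_riesz T_ce.
have le_dir : directed le.
  split.
  - by have [a Aa] := A0; constructor; exists a; split; [exact: AR | exact: lm].
  - by move=> a; exact: lexx.
  - by move=> a b c ab bc; exact: le_trans bc ab.
  - move=> [a [Ra ma]] [b [Rb mb]].
    have Pab : P (rmeet a b) by split; [case: (Rlat _ _ Ra Rb) | rewrite rmeet_ge ma].
    by exists (exist _ _ Pab); [exact: rmeet_lbl | exact: rmeet_lbr].
pose x (a : I) := sval a.
have xinf : infs_in setT (range x) m.
  apply/infs_inP; split=> // [_ [[a [Ra ma]] _ <-]//|w _ lbw].
  apply: um => // a Aa; apply: lbw.
  have Pa : P a by split; [exact: AR | exact: lm].
  by exists (exist _ a Pa).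
have xdec a b : le a b -> x b <= x a by [].
(* Order continuity gives [T \o x] the limit [T m]. This net is [x] itself, so uniqueness of the
   infimum yields [m = T m]. *)
have := (decreasing_order_cvg _ le_dir xdec).2 xinf.
move=> /(ce_order_continuous T_ce le_dir).
have -> : T \o x = x.
  by apply: funext => -[a [Ra ma]]; exact: range_fixed.
move=> /(decreasing_order_cvg _ le_dir xdec) /(infs_in_uniq xinf) ->.
by exists m.
Qed.

Lemma uc_range_inf_closed : inf_closed uc_range.
Proof.
move=> B BH [b Bb] Bge0.
have BE : B = j @` (j @^-1` B `&` range T).
  apply/seteqP; split=> [y By|_ [x [Bx _] <-]//].
  by have [x Rx xy] := BH _ By; exists x => //; split=> //=; rewrite xy.
rewrite BE; have [||x [Bx _]|m Rm /uc_inf minf] :=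
  ce_range_inf_closed (A := j @^-1` B `&` range T).
- by move=> x [].
- by have [x Rx xb] := BH _ Bb; exists x; split=> //=; rewrite xb.
- by rewrite -uc_ge0 Bge0.
by exists (j m) => //; exists m.
Qed.

Lemma ext_pos_cone f g : ext_pos j T f g -> sup_cone uc_range g.
Proof.
move=> [I [le [x [[[i0] _ _ _] _ x0 _ /sups_inP[_ ug lg]]]]].
have Tx0 a : 0 <= j (T (x a)) by rewrite uc_ge0; exact: ce_positive.
have Txg a : j (T (x a)) <= g by apply: ug; exists a.
apply: sup_cone_intro; first exact: le_trans (Tx0 i0) (Txg i0).
move=> z ub; apply: lg => // _ [a _ <-].
apply: ub; [|exact: Tx0|exact: Txg].
by exists (T (x a)) => //; exists (x a).
Qed.

(** The extension fixes the cone: the elements of [range T] between [0] and [g], indexed by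
    themselves, form an increasing net that [T] leaves unchanged. *)
Lemma cone_ext_pos g : sup_cone uc_range g -> ext_pos j T g g.
Proof.
move=> [g0 /sups_inP[_ ug lg]].
have [[R0 RL] Rlat] := ce_range_riesz T_ce.
pose P x := [/\ range T x, 0 <= x & j x <= g].
pose I := {x : E | P x}.
have xT (a : I) : T (sval a) = sval a.
  by case: a => x /= [Rx _ _]; exact: range_fixed.
have xsup : sups_in setT (range (fun a : I => j (sval a))) g.
  apply/sups_inP; split=> // [_ [[x Px] _ <-]|w _ ubw].
    by case: Px.
  apply: lg => // _ [[x Rx <-] x0 xg]; apply: ubw.
  by rewrite uc_ge0 in x0; have Px : P x by []; exists (exist _ x Px).
exists I, (fun a b => sval a <= sval b), sval; split=> //.
- split.
  + by constructor; exists 0; split; rewrite ?linear0.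
  + by move=> a; exact: lexx.
  + by move=> a b c; exact: le_trans.
  + move=> [a [Ra a0 ag]] [b [Rb b0 bg]].
    have Pab : P (rjoin a b).
      split; first by case: (Rlat _ _ Ra Rb).
        exact: le_trans a0 (rjoin_ubl _ _).
      by rewrite (uc_join j_univ) rjoin_le ag.
    by exists (exist _ _ Pab); [exact: rjoin_ubl | exact: rjoin_ubr].
- by case=> x [].
suff -> : j \o (T \o sval) = (fun a : I => j (sval a)) by [].
by apply: funext => a /=; rewrite xT.
Qed.

Lemma ext_pos_nat_dom f g : ext_pos j T f g -> nat_dom_pos j T f.
Proof.
move=> [I [le [x [dir xinc x0 xf xg]]]]; split.
  have [[i0] _ _ _] := dir; have /sups_inP[_ uf _] := xf.
  by apply: (@le_trans _ _ (j (x i0))); [rewrite uc_ge0 | apply: uf; exists i0].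
exists I, le, x; split=> //; exists g.
by have /sups_inP[] := xg.
Qed.

Lemma ext_rangeE : ext_range j T = sup_span uc_range.
Proof.
apply/seteqP; split=> [g [f _ [f1 [f2 [g1 [g2 [P1 P2 _ ->]]]]]]|].
  by exists g1, g2; split=> //; [exact: ext_pos_cone P1 | exact: ext_pos_cone P2].
move=> _ [g1 [g2 [/cone_ext_pos P1 /cone_ext_pos P2 ->]]]; exists (g1 - g2).
  by exists g1, g2; split=> //; [exact: ext_pos_nat_dom P1 | exact: ext_pos_nat_dom P2].
by exists g1, g2, g1, g2.
Qed.

(** The net consists of the positive [x] below [f] that have a majorant [h] in [range T] with
    [j h <= v]. The majorant bounds the images, as [T x <= T h = h]; distributivity applied to
    [f = rmeet v f] shows that such [x] still have supremum [f]. *)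
Lemma cone_dominated_nat_dom f v : sup_cone uc_range v -> 0 <= f -> f <= v ->
  nat_dom_pos j T f.
Proof.
move=> [v0 vsup] f0 fv; split=> //.
have [[R0 RL] Rlat] := ce_range_riesz T_ce.
pose P x := [/\ 0 <= x, j x <= f & exists h, [/\ range T h, x <= h & j h <= v]].
pose I := {x : E | P x}.
exists I, (fun a b => sval a <= sval b), sval; split=> //.
- split.
  + constructor; exists 0; split; rewrite ?linear0 //.
    by exists 0; split; rewrite ?linear0.
  + by move=> a; exact: lexx.
  + by move=> a b c; exact: le_trans.
  + move=> [a [a0 af [h [Rh ah hv]]]] [b [b0 bf [k [Rk bk kv]]]].
    have Pab : P (rjoin a b).
      split; first exact: le_trans a0 (rjoin_ubl _ _).
        by rewrite (uc_join j_univ) rjoin_le af.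
      exists (rjoin h k); split; first by case: (Rlat _ _ Rh Rk).
        by rewrite rjoin_le (le_trans ah) ?rjoin_ubl // (le_trans bk) ?rjoin_ubr.
      by rewrite (uc_join j_univ) rjoin_le hv.
    by exists (exist _ _ Pab); [exact: rjoin_ubl | exact: rjoin_ubr].
- by case=> x [].
- apply/sups_inP; split=> // [_ [[x Px] _ <-]|w _ ubw]; first by case: Px.
  have -> : f = rmeet v f.
    by apply: le_anti; rewrite rmeet_ge fv lexx rmeet_lbr.
  apply: (rmeet_sup vsup) => _ [[h Rh <-] h0 hv].
  apply: uc_dense_sup; first by rewrite rmeet_ge h0.
  move=> x x0; rewrite rmeet_ge uc_le => /andP[xh xf].
  have Px : P x by split=> //; exists h.
  by apply: ubw; exists (exist _ x Px).
exists v => _ [[x Px] _ <-] /=; have [x0 xf [h [Rh xh hv]]] := Px.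
by apply: (le_trans _ hv); rewrite uc_le -(range_fixed Rh) T_le.
Qed.

(** Add the two nets over the product of their index sets. *)
Lemma nat_dom_posD f g :
  nat_dom_pos j T f -> nat_dom_pos j T g -> nat_dom_pos j T (f + g).
Proof.
move=> [f0 [I [leI [x [dI xinc x0 /sups_inP[_ uf lf] [bf ubf]]]]]].
move=> [g0 [J [leJ [y [dJ yinc y0 /sups_inP[_ ug lg] [bg ubg]]]]]].
have [[i0] reflI transI dirI] := dI; have [[k0] reflJ transJ dirJ] := dJ.
split; first exact: riesz_addr_ge0.
exists (I * J)%type, (fun a b => leI a.1 b.1 /\ leJ a.2 b.2),
  (fun a => x a.1 + y a.2); split.
- split; first by constructor.
  + by move=> a; split.
  + by move=> a b c [ab ab'] [bc bc']; split; [exact: transI bc | exact: transJ bc'].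
  + move=> [a a'] [b b']; have [c ac bc] := dirI a b.
    by have [c' ac' bc'] := dirJ a' b'; exists (c, c').
- by move=> a b [ab ab']; apply: riesz_leD2; [exact: xinc | exact: yinc].
- by move=> a; exact: riesz_addr_ge0.
- apply/sups_inP; split=> // [_ [a _ <-] /=|w _ ubw].
    by rewrite linearD riesz_leD2 //; [apply: uf; exists a.1 | apply: ug; exists a.2].
  rewrite -riesz_leBrDr; apply: lf => // _ [a _ <-].
  rewrite riesz_leBrDr addrC -riesz_leBrDr; apply: lg => // _ [b _ <-] /=.
  by rewrite riesz_leBrDr addrC -linearD; apply: ubw; exists (a, b).
exists (bf + bg) => _ [a _ <-] /=; rewrite !linearD.
by apply: riesz_leD2; [apply: ubf; exists a.1 | apply: ubg; exists a.2].
Qed.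

Lemma L1B f g : L1 j T f -> L1 j T g -> L1 j T (f - g).
Proof.
move=> [f1 [f2 [P1 P2 ->]]] [g1 [g2 [Q1 Q2 ->]]].
exists (f1 + g2), (f2 + g1); split; [exact: nat_dom_posD..|].
by rewrite opprB addrACA opprD.
Qed.

Lemma cone_dominated_L1 f v : sup_cone uc_range v -> rabs f <= v -> L1 j T f.
Proof.
move=> Qv; have [v0 _] := Qv; rewrite rabs_le => /andP[vf fv].
(* Positive and negative parts of [f], both between [0] and [v]. *)
exists (rjoin f 0), (rjoin f 0 - f); split; last by rewrite subKr.
  by apply: (cone_dominated_nat_dom Qv); rewrite ?rjoin_ubr // rjoin_le fv.
apply: (cone_dominated_nat_dom Qv); first by rewrite riesz_subr_ge0 rjoin_ubl.
rewrite riesz_leBlDr rjoin_le -{1}[f]add0r riesz_leDr v0 /=.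
by rewrite -(subrr v) riesz_leDl.
Qed.

Lemma ext_range_inf_closed : inf_closed (ext_range j T).
Proof.
rewrite ext_rangeE.
exact: sup_span_inf_closed Eu_dc uc_range_riesz uc_range_inf_closed.
Qed.

(** The infimum defining the norm is also an infimum in [Eu], where [rabs f] is a competing lower
    bound; hence the norm is itself a majorant. *)
Lemma Linfty_normP f : (exists2 g, ext_range j T g & rabs f <= g) ->
  [/\ ext_range j T (Linfty_norm j T f), rabs f <= Linfty_norm j T f &
      forall g, ext_range j T g -> rabs f <= g -> Linfty_norm j T f <= g].
Proof.
move=> [g Gg fg]; pose A := [set g | ext_range j T g /\ rabs f <= g].
have [|||m Gm infT] := ext_range_inf_closed (A := A).
- by move=> x [].
- by exists g.
- by move=> x [_]; exact: le_trans (rabs_ge0 f).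
have infG := infs_in_subset Gm infT.
have -> : Linfty_norm j T f = m.
  by apply: (infs_in_uniq _ infG); apply: xgetPex; exists m.
have /infs_inP[_ lm um] := infT; split=> // [|h Gh fh]; last exact: lm.
by apply: um => // x [].
Qed.

End NaturalDomain.

(** * Construction of the limit and strong convergence to it *)

Theorem theorem4p1 (R : realType) (E Eu : rieszType R)
    (j : {linear E -> Eu}) (T : {linear E -> E})
    (E_complete : dedekind_complete (E := E) setT)
    (E_unit : exists e : E, weak_order_unit e)
    (j_univ : universal_completion j)
    (T_ce : conditional_expectation T)
    (T_spos : strictly_positive T)
    (I : Type) (le : I -> I -> Prop) (le_dir : directed le)
    (f : I -> Eu) (f_Linfty : forall a, Linfty j T (f a))
    (f_cauchy : strong_cauchy j T le f) :
  exists2 l : Eu, Linfty j T l & strong_cvg j T le f l.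
Proof.
have [_ leI le_tr dir] := le_dir.
have [v [[a0 vsup] [a1 [_ /infs_inP[G0 _ vinf] _]]]] := f_cauchy.
have [a2 a02 a12] := dir a0 a1.
pose G := ext_range j T; pose N := Linfty_norm j T.
have GE : G = sup_span (uc_range j T) := ext_rangeE j_univ T_ce.
have Ginf : inf_closed G := ext_range_inf_closed E_complete j_univ T_ce.
have Hriesz := uc_range_riesz j_univ T_ce.
have GB x y : G x -> G y -> G (x - y) by rewrite GE; exact: sup_spanB.
have GD x y : G x -> G y -> G (x + y).
  by move=> Gx Gy; rewrite -[y]opprK; apply: (GB) => //; rewrite -sub0r; exact: GB.
have normP h : (exists2 g, G g & rabs h <= g) ->
    [/\ G (N h), rabs h <= N h & forall g, G g -> rabs h <= g -> N h <= g].
  exact: Linfty_normP.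
have Gv a : le a2 a -> G (v a).
  by move=> aa; have /sups_inP[] := vsup _ (le_tr _ _ _ a02 aa).
have fv a b c : le a2 a -> le a b -> le a c -> rabs (f b - f c) <= v a.
  move=> aa ab ac; have /sups_inP[_ uv _] := vsup _ (le_tr _ _ _ a02 aa).
  (* The majorant [gb + gc] ensures that the norm of the difference is a true infimum, not the
     default value. *)
  have [_ [gb Gb fgb]] := f_Linfty b; have [_ [gc Gc fgc]] := f_Linfty c.
  have [|_ fN _] := normP (f b - f c).
    by exists (gb + gc); [exact: GD | exact: rabs_leB].
  by apply: (le_trans fN); apply: uv; exists b, c.
have vdec a b : le a2 a -> le a b -> v b <= v a.
  move=> aa ab; have ab0 := le_tr _ _ _ (le_tr _ _ _ a02 aa) ab.
  have /sups_inP[_ _ lv] := vsup _ ab0.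
  have /sups_inP[_ uv _] := vsup _ (le_tr _ _ _ a02 aa).
  apply: lv; first exact: Gv.
  by move=> n [c [d [bc bd ->]]]; apply: uv; exists c, d; split=> //; exact: le_tr ab _.
(* Every tail supremum of [v] dominates some [v c] with [c] beyond [a2], so [w] is below all of them
   and hence below their infimum [0]. *)
have v_le0 w : G w -> (forall a, le a2 a -> w <= v a) -> w <= 0.
  move=> Gw wv; apply: vinf => // s [a a1a /sups_inP[_ us _]].
  have [c ac c2] := dir a a2; apply: (le_trans (wv _ c2)); apply: us.
  by exists c.
(* By the Cauchy condition every [f a - v a] lies below every [f b + v b]. *)
have fvfv a b : le a2 a -> le a2 b -> f a - v a <= f b + v b.
  move=> aa bb; have [c ac bc] := dir a b; apply: (@le_trans _ _ (f c)).
    have := fv _ _ _ aa (leI a) ac; rewrite rabs_le => /andP[_].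
    by rewrite !riesz_leBlDr addrC.
  have := fv _ _ _ bb bc (leI b); rewrite rabs_le => /andP[_].
  by rewrite riesz_leBlDr addrC.
have [l /sups_inP[_ ul ll]] :
    sups_in setT [set f a - v a | a in [set a | le a2 a]] !=set0.
  have [Eu_dc _] := uc_complete j_univ; apply: Eu_dc => //.
    by exists (f a2 - v a2); exists a2 => //; exact: leI.
  by exists (f a2 + v a2); split=> // _ [a aa <-]; exact: fvfv.
(* Each [f a + v a] bounds the set whose supremum is [l], and [f a - v a] belongs to that set. *)
have flv a : le a2 a -> rabs (f a - l) <= v a.
  move=> aa; rewrite rabs_le; apply/andP; split.
    rewrite riesz_leBrDr addrC riesz_leBlDr; apply: ll => // _ [b bb <-].
    exact: fvfv.
  by rewrite riesz_leBlDr addrC -riesz_leBlDr; apply: ul; exists a.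
exists l.
  have [Lf [g Gg fg]] := f_Linfty a2; have fl := flv _ (leI a2).
  have Gv2 := Gv _ (leI a2).
  have Qv : sup_cone (uc_range j T) (v a2).
    apply: (sup_span_ge0 Hriesz (uc_range_inf_closed E_complete j_univ T_ce)).
      by rewrite -GE.
    exact: le_trans (rabs_ge0 _) fl.
  (* The correction [f a2 - l] is dominated by [v a2], an element of the cone, so it lies in [L1]
     and has a majorant in [G]. *)
  have lE : l = f a2 - (f a2 - l) by rewrite subKr.
  split; first by rewrite lE; apply: L1B => //; exact: cone_dominated_L1 Qv fl.
  by exists (g + v a2); [exact: GD | rewrite lE; exact: rabs_leB].
have nP a : le a2 a -> [/\ G (N (f a - l)), 0 <= N (f a - l) & N (f a - l) <= v a].
  move=> aa; have [|Gn fn nle] := normP (f a - l).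
    by exists (v a); [exact: Gv | exact: flv].
  split=> //; first exact: le_trans (rabs_ge0 _) fn.
  by apply: nle; [exact: Gv | exact: flv].
exists a2; split.
- exists 0, (v a2); split=> //; first exact: Gv.
  move=> a aa; have [Gn n0 nv] := nP _ aa; split=> //; rewrite n0 /=.
  exact: le_trans nv (vdec _ _ (leI a2) aa).
- apply/infs_inP; split=> // [s [a aa /sups_inP[_ us _]]|w Gw lbw].
    have [_ n0 _] := nP _ aa; apply: (le_trans n0); apply: us.
    by exists a.
  apply: v_le0 => // a aa.
  have nv b : le a b -> N (f b - l) <= v a.
    move=> ab; have [_ _ nv] := nP _ (le_tr _ _ _ aa ab).
    exact: le_trans nv (vdec _ _ aa ab).
  (* The tail supremum exists in [G] because [v a], in [G], bounds the tail; being at most [v a], it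
     forces [w <= v a]. *)
  pose B := (fun b => N (f b - l)) @` [set b | le a b].
  have [|||s Gs ssup] := inf_closed_sup (A := B) GB Ginf _ _ (Gv _ aa).
  + by move=> _ [b ab <-]; have [] := nP _ (le_tr _ _ _ aa ab).
  + by exists (N (f a - l)); exists a.
  + by move=> _ [b ab <-]; exact: nv.
  apply: (@le_trans _ _ s).
    by apply: lbw; exists a => //; exact: sups_in_subset.
  by have /sups_inP[_ _ ls] := ssup; apply: ls => // _ [b ab <-]; exact: nv.
(* Lower limit: a tail infimum [s] is below [N (f b - l) <= v b <= v c] for [b] beyond [a] and [c],
   whence [s <= 0]. *)
apply/sups_inP; split=> // [s [a aa /infs_inP[Gs ls _]]|w Gw ubw].
  apply: v_le0 => // c cc; have [b ab cb] := dir a c.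
  have [_ _ nv] := nP _ (le_tr _ _ _ aa ab).
  apply: le_trans (vdec _ _ cc cb); apply: le_trans nv; apply: ls.
  by exists b.
(* Conversely, one tail infimum that exists in [G] and is positive suffices for [0 <= w]. *)
pose B := (fun b => N (f b - l)) @` [set b | le a2 b].
have [|||s Gs sinf] := Ginf B.
- by move=> _ [b ab <-]; have [] := nP _ ab.
- by exists (N (f a2 - l)); exists a2 => //; exact: leI.
- by move=> _ [b ab <-]; have [] := nP _ ab.
have /infs_inP[_ _ gs] := sinf; apply: (@le_trans _ _ s).
  by apply: gs => // _ [b ab <-]; have [] := nP _ ab.
by apply: ubw; exists a2; [exact: leI | exact: infs_in_subset].
Qed.
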